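(* Let $A\in\mathbb{R}^{m\times n}$, $b\in\mathbb{R}^m$, $c\in\mathbb{R}^n$, $d=(A,b,c)$, and suppose that the condition numbers $\delta_P$ and $\delta_D$ of $d$ are both positive. Let $(x^*,u^* )$ be any primal-dual solution pair for the linear program $\min c^Tx$ s.t. $Ax=b$, $x\ge0$ and its dual $\max b^Tu$ s.t. $c-A^Tu\ge0$. Let $\bar u\in\mathbb{R}^m$, $\bar x\in\mathbb{R}^n$ be arbitrary, let $\beta>0$, and define $C_*:=\max(\|x^*-\bar x\|,\|u^*-\bar u\|)$. Then the unique solution $x(\beta)$ of $$\min_{x\ge0}\ f_\beta(x):=c^Tx-\bar u^T(Ax-b)+\frac{\beta}{2}\|Ax-b\|^2+\frac{1}{2\beta}\|x-\bar x\|^2$$ satisfies $$\|Ax(\beta)-b\|\le\frac1\beta(1+\sqrt2)\,C_*,\qquad \|x(\beta)-x^*\|\le\sqrt6\,C_*.$$ If in addition $$\beta\ge\frac{10\,C_*}{\|d\|\min(\delta_P,\delta_D)},$$ then $$|c^Tx^*-c^Tx(\beta)|\le\frac1\beta\left[\frac{25\,C_*}{2\delta_P\delta_D}+6C_*^2+\sqrt6\,\|\bar x\|\,C_*\right].$$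
   Context: $\|\cdot\|$ on vectors is the Euclidean norm. For data $d=(A,b,c)$, $\|d\|:=\max\{\|A\|_F,\|b\|_2,\|c\|_2\}$. Throughout, $A$ is assumed to have full row rank $m$. Let $\mathrm{Pri}\emptyset$ be the set of data $d'=(A',b',c')$ (same dimensions) for which the primal program $\min c'^Tx$ s.t. $A'x=b'$, $x\ge0$ is infeasible, and $\mathrm{Dual}\emptyset$ the set of data for which the dual program $\max b'^Tu$ s.t. $c'-A'^Tu\ge0$ is infeasible. Define $$\delta_P:=\frac{\mathrm{dist}(d,\mathrm{Pri}\emptyset)}{\|d\|},\qquad \delta_D:=\frac{\mathrm{dist}(d,\mathrm{Dual}\emptyset)}{\|d\|},$$ where $\mathrm{dist}(d,S)=\inf_{d'\in S}\|d-d'\|$. When $\delta_P,\delta_D>0$ both programs are feasible, so both have solutions. *)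

(* Defs.v *)
From mathcomp Require Import all_boot all_order all_algebra.
From mathcomp Require Import boolp classical_sets reals.

Set Implicit Arguments.
Unset Strict Implicit.
Unset Printing Implicit Defensive.

Import Order.TTheory GRing.Theory Num.Theory.

Local Open Scope classical_set_scope.
Local Open Scope ring_scope.

(* Frobenius norm; on column vectors ('cV_p is 'M_(p, 1)) it is the Euclidean
   norm. The library norm `|M| on matrices is not used: it is the sup norm. *)
Definition norm2 (R : realType) (p q : nat) (M : 'M[R]_(p, q)) : R :=
  Num.sqrt (\sum_i \sum_j M i j ^+ 2).

Definition dot (R : realType) (p : nat) (v w : 'cV[R]_p) : R :=
  (v^T *m w) 0 0.

Definition nonneg (R : realType) (p : nat) (v : 'cV[R]_p) : Prop :=
  forall i, 0 <= v i 0.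

Definition is_argmin (R : realType) (T : Type) (S : set T) (f : T -> R)
  (x : T) : Prop := S x /\ forall y, S y -> f x <= f y.

Definition is_argmax (R : realType) (T : Type) (S : set T) (f : T -> R)
  (x : T) : Prop := S x /\ forall y, S y -> f y <= f x.

(* Triples (A, b, c). *)
Definition lpdata (R : realType) (m n : nat) : Type :=
  ('M[R]_(m, n) * 'cV[R]_m * 'cV[R]_n)%type.

Definition primal_feasible (R : realType) (m n : nat) (d : lpdata R m n) :
  set 'cV[R]_n := let: (A, b, c) := d in
  [set x | A *m x = b /\ nonneg x].

Definition dual_feasible (R : realType) (m n : nat) (d : lpdata R m n) :
  set 'cV[R]_m := let: (A, b, c) := d in
  [set u | nonneg (c - A^T *m u)].

Definition primal_solution (R : realType) (m n : nat) (d : lpdata R m n)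
  (x : 'cV[R]_n) : Prop := let: (A, b, c) := d in
  is_argmin (primal_feasible d) (dot c) x.

Definition dual_solution (R : realType) (m n : nat) (d : lpdata R m n)
  (u : 'cV[R]_m) : Prop := let: (A, b, c) := d in
  is_argmax (dual_feasible d) (dot b) u.

Definition data_norm (R : realType) (m n : nat) (d : lpdata R m n) : R :=
  let: (A, b, c) := d in
  Num.max (norm2 A) (Num.max (norm2 b) (norm2 c)).

Definition data_sub (R : realType) (m n : nat) (d d' : lpdata R m n) :
  lpdata R m n := let: (A, b, c) := d in let: (A', b', c') := d' in
  (A - A', b - b', c - c').

(* Real-valued: if S is empty the library's inf returns 0 (and not +oo). The
   two sets below are nonempty as soon as m and n are positive; when m or n
   is 0 a condition number built on an empty set is 0, hence not positive. *)
Definition data_dist (R : realType) (m n : nat) (d : lpdata R m n)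
  (S : set (lpdata R m n)) : R :=
  inf [set data_norm (data_sub d d') | d' in S].

Definition primal_infeasible (R : realType) (m n : nat) :
  set (lpdata R m n) := [set d | primal_feasible d = set0].

Definition dual_infeasible (R : realType) (m n : nat) :
  set (lpdata R m n) := [set d | dual_feasible d = set0].

Definition delta_P (R : realType) (m n : nat) (d : lpdata R m n) : R :=
  data_dist d (@primal_infeasible R m n) / data_norm d.

Definition delta_D (R : realType) (m n : nat) (d : lpdata R m n) : R :=
  data_dist d (@dual_infeasible R m n) / data_norm d.

Definition f_beta (R : realType) (m n : nat) (d : lpdata R m n)
  (ubar : 'cV[R]_m) (xbar : 'cV[R]_n) (beta : R) (x : 'cV[R]_n) : R :=
  let: (A, b, c) := d in
  dot c x - dot ubar (A *m x - b)
    + beta / 2 * norm2 (A *m x - b) ^+ 2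
    + 1 / (2 * beta) * norm2 (x - xbar) ^+ 2.

(* Main.v *)
(* For [u = ubar - beta (A x(beta) - b)], the pair [(x(beta), u)] is the
   proximal point of [(xbar, ubar)] for the maximal monotone operator whose
   zeros are the primal-dual solutions. Firm nonexpansiveness bounds
   [|x(beta) - xs|^2] and [|u - ubar|^2] by [2 Cs^2], which gives the first two
   estimates. For the third, feasibility of [xs] and [us] bounds
   [beta |c.(x(beta) - xs)|] by [Cs^2 + |us| |u - ubar|], and a dual solution
   satisfies [|us| <= 1 / (delta_P delta_D)]: a rank-one change of [A] together
   with a change of [b], both of size at most [|d| / (delta_D |us|)] up to an
   arbitrarily small error, turns [us] into a certificate of primal
   infeasibility. *)
Require Import Defs.
From mathcomp Require Import all_boot all_order all_algebra.
From mathcomp Require Import boolp classical_sets reals.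
From mathcomp Require Import topology normedtype derive ring lra.

Set Implicit Arguments.
Unset Strict Implicit.
Unset Printing Implicit Defensive.

Import Order.TTheory GRing.Theory Num.Theory.
Import numFieldNormedType.Exports.

Local Open Scope classical_set_scope.
Local Open Scope ring_scope.

(** * Dot product and Euclidean norm *)

Lemma dotE (R : realType) p (v w : 'cV[R]_p) : dot v w = \sum_i v i 0 * w i 0.
Proof. by rewrite /dot mxE; under eq_bigr do rewrite mxE. Qed.

Lemma dotC (R : realType) p (v w : 'cV[R]_p) : dot v w = dot w v.
Proof. by rewrite !dotE; apply: eq_bigr => i _; rewrite mulrC. Qed.

Lemma dotDl (R : realType) p (u v w : 'cV[R]_p) :
  dot (u + v) w = dot u w + dot v w.
Proof. by rewrite /dot linearD mulmxDl mxE. Qed.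

Lemma dotZl (R : realType) p a (v w : 'cV[R]_p) : dot (a *: v) w = a * dot v w.
Proof. by rewrite /dot linearZ -scalemxAl mxE. Qed.

Lemma dotNl (R : realType) p (v w : 'cV[R]_p) : dot (- v) w = - dot v w.
Proof. by rewrite -scaleN1r dotZl mulN1r. Qed.

Lemma dotDr (R : realType) p (u v w : 'cV[R]_p) :
  dot u (v + w) = dot u v + dot u w.
Proof. by rewrite !(dotC u) dotDl. Qed.

Lemma dotZr (R : realType) p a (v w : 'cV[R]_p) : dot v (a *: w) = a * dot v w.
Proof. by rewrite !(dotC v) dotZl. Qed.

Lemma dotNr (R : realType) p (v w : 'cV[R]_p) : dot v (- w) = - dot v w.
Proof. by rewrite !(dotC v) dotNl. Qed.

Lemma dot0l (R : realType) p (v : 'cV[R]_p) : dot 0 v = 0.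
Proof. by rewrite -(scale0r v) dotZl mul0r. Qed.

Definition dot_lin := (dotDl, dotDr, dotNl, dotNr, dotZl, dotZr).

Lemma dot_trmul (R : realType) p q (A : 'M[R]_(p, q)) (u : 'cV_p) (x : 'cV_q) :
  dot (A^T *m u) x = dot u (A *m x).
Proof. by rewrite /dot trmx_mul trmxK mulmxA. Qed.

Lemma dot_delta (R : realType) p (v : 'cV[R]_p) i :
  dot (delta_mx i 0) v = v i 0.
Proof. by rewrite /dot trmx_delta -rowE mxE. Qed.

Lemma dot_nonneg_ge0 (R : realType) p (v w : 'cV[R]_p) :
  nonneg v -> nonneg w -> 0 <= dot v w.
Proof. by move=> v0 w0; rewrite dotE sumr_ge0 // => i _; rewrite mulr_ge0. Qed.

Lemma norm2_ge0 (R : realType) p q (M : 'M[R]_(p, q)) : 0 <= norm2 M.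
Proof. exact: sqrtr_ge0. Qed.

Lemma sqr_norm2 (R : realType) p (v : 'cV[R]_p) : norm2 v ^+ 2 = dot v v.
Proof.
have -> : dot v v = \sum_i \sum_(j < 1) v i j ^+ 2.
  by rewrite dotE; apply: eq_bigr => i _; rewrite big_ord1 expr2.
by rewrite sqr_sqrtr // !sumr_ge0 // => i _; rewrite sumr_ge0 // => j _;
  rewrite sqr_ge0.
Qed.

Lemma dotvv_ge0 (R : realType) p (v : 'cV[R]_p) : 0 <= dot v v.
Proof. by rewrite -sqr_norm2 sqr_ge0. Qed.

Lemma norm2E (R : realType) p (v : 'cV[R]_p) : norm2 v = Num.sqrt (dot v v).
Proof. by rewrite -sqr_norm2 sqrtr_sqr ger0_norm ?norm2_ge0. Qed.

Lemma norm2N (R : realType) p (v : 'cV[R]_p) : norm2 (- v) = norm2 v.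
Proof. by rewrite !norm2E dotNl dotNr opprK. Qed.

Lemma norm2Z (R : realType) p a (v : 'cV[R]_p) :
  norm2 (a *: v) = `|a| * norm2 v.
Proof.
by rewrite !norm2E dotZl dotZr mulrA -expr2 sqrtrM ?sqr_ge0 // sqrtr_sqr.
Qed.

Lemma norm2_eq0 (R : realType) p (v : 'cV[R]_p) : (norm2 v == 0) = (v == 0).
Proof.
apply/eqP/eqP => [v0|->]; last by rewrite norm2E dot0l sqrtr0.
have /eqP : dot v v = 0 by rewrite -sqr_norm2 v0 expr0n.
rewrite dotE psumr_eq0 => [/allP vi0|i _]; last by rewrite -expr2 sqr_ge0.
apply/matrixP => i j; rewrite ord1 mxE.
by have := vi0 i (mem_index_enum _); rewrite /= mulf_eq0 orbb => /eqP.
Qed.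

Lemma norm2_gt0 (R : realType) p (v : 'cV[R]_p) : (0 < norm2 v) = (v != 0).
Proof. by rewrite lt_neqAle norm2_ge0 andbT eq_sym norm2_eq0. Qed.

Lemma norm2_mx0 (R : realType) p q : norm2 (0 : 'M[R]_(p, q)) = 0.
Proof.
by rewrite /norm2 big1 ?sqrtr0 // => i _; rewrite big1 // => j _;
  rewrite mxE expr0n.
Qed.

Lemma norm2_outer (R : realType) p q (u : 'cV[R]_p) (w : 'cV[R]_q) :
  norm2 (u *m w^T) = norm2 u * norm2 w.
Proof.
rewrite !norm2E -sqrtrM ?dotvv_ge0 // /norm2 !dotE mulr_suml.
congr Num.sqrt; apply: eq_bigr => i _; rewrite mulr_sumr.
by apply: eq_bigr => j _; rewrite !mxE big_ord1 mxE; ring.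
Qed.

(** Cauchy-Schwarz: the squared length of [|w|^2 v - (v.w) w] is [|w|^2] times
    [|v|^2 |w|^2 - (v.w)^2]. *)
Lemma dot_le_norm2 (R : realType) p (v w : 'cV[R]_p) :
  dot v w <= norm2 v * norm2 w.
Proof.
have [->|w0] := eqVneq w 0; first by rewrite dotC dot0l mulr_ge0 ?norm2_ge0.
rewrite (le_trans (ler_norm _)) // -ler_sqr ?nnegrE ?mulr_ge0 ?norm2_ge0 //.
rewrite real_normK ?num_real // exprMn.
have := dotvv_ge0 (norm2 w ^+ 2 *: v - dot v w *: w).
move: w0; rewrite !dot_lin -!sqr_norm2 (dotC w v) -norm2_gt0 => w0.
set e := (X in 0 <= X -> _).
have -> : e = norm2 w ^+ 2 * (norm2 v ^+ 2 * norm2 w ^+ 2 - dot v w ^+ 2).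
  by rewrite /e; ring.
by rewrite pmulr_rge0 ?exprn_gt0 // subr_ge0.
Qed.

Lemma norm2D (R : realType) p (v w : 'cV[R]_p) :
  norm2 (v + w) <= norm2 v + norm2 w.
Proof.
rewrite -ler_sqr ?nnegrE ?addr_ge0 ?norm2_ge0 //.
rewrite sqr_norm2 !dot_lin (dotC w v) -!sqr_norm2.
have := dot_le_norm2 v w; nra.
Qed.

Lemma coord_le_norm2 (R : realType) p (v : 'cV[R]_p) i : v i 0 <= norm2 v.
Proof.
rewrite -[norm2 v]mul1r -dot_delta (le_trans (dot_le_norm2 _ _)) //.
rewrite ler_wpM2r ?norm2_ge0 // norm2E dot_delta !mxE !eqxx.
by rewrite sqrtr1.
Qed.

(** * Farkas' lemma and strong duality *)

(* The generated cone is encoded as the least convex cone containing [s]. The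
   induction eliminates one generator [a]: a witness [z0] against the remaining
   ones, normalised to [dot a z0 = -1], shifts every other vector [v] to
   [v + dot v z0 *: a], which is orthogonal to [z0]. *)
Lemma farkas (R : realType) (p : nat) (s : seq 'cV[R]_p) (c : 'cV[R]_p)
    (K : set 'cV[R]_p) :
  K 0 -> (forall v w, K v -> K w -> K (v + w)) ->
  (forall t v, 0 <= t -> K v -> K (t *: v)) ->
  (forall a, a \in s -> K a) ->
  (forall z, (forall a, a \in s -> 0 <= dot a z) -> 0 <= dot c z) ->
  K c.
Proof.
move=> K0 KD KZ; have [k] := ubnP (size s); elim: k s c => // k IH.
move=> [|a s] c; [move=> _ _ imp|rewrite ltnS => sk Ks imp].
  (* With no generators left, testing against [- c] forces [c = 0]. *)
  have := imp (- c) (fun _ => ltac:(by [])).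
  rewrite dotNr oppr_ge0 -sqr_norm2 => c0.
  have /eqP : norm2 c ^+ 2 = 0 by apply/le_anti; rewrite c0 sqr_ge0.
  by rewrite sqrf_eq0 norm2_eq0 => /eqP ->.
have [imp'|] := pselect (forall z, (forall a, a \in s -> 0 <= dot a z) ->
    0 <= dot c z).
  by apply: (IH s) imp' => // v vs; apply: Ks; rewrite inE vs orbT.
move=> /existsNP[z1 /not_implyP[sz1 /negP]]; rewrite -ltNge => cz1.
(* [z1] violates the conclusion, hence some constraint, which can only be that of [a]. *)
have az1 : dot a z1 < 0.
  rewrite ltNge; apply/negP => az1; suff : 0 <= dot c z1 by rewrite leNgt cz1.
  by apply: imp => v; rewrite inE => /predU1P[->|/sz1].
pose z0 := (- dot a z1)^-1 *: z1.
have t0 : 0 < (- dot a z1)^-1 by rewrite invr_gt0 oppr_gt0.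
have az0 : dot a z0 = -1.
  by rewrite dotZr -[X in _ * X]opprK mulrN mulVf // gt_eqF // oppr_gt0.
have sz0 v : v \in s -> 0 <= dot v z0.
  by move=> vs; rewrite dotZr mulr_ge0 ?sz1 // ltW.
have cz0 : dot c z0 < 0 by rewrite dotZr pmulr_rlt0.
have Ka : K a by apply: Ks; rewrite mem_head.
pose proj v := v + dot v z0 *: a.
have -> : c = proj c + (- dot c z0) *: a by rewrite scaleNr addrK.
apply: (KD); last by apply: (KZ) => //; rewrite oppr_ge0 ltW.
apply: (IH [seq proj v | v <- s]); first by rewrite size_map.
  move=> _ /mapP[v vs ->]; apply: (KD); first by apply: Ks; rewrite inE vs orbT.
  by apply: KZ; rewrite ?sz0.
(* The adjoint of [proj] sends [z] to [z + dot a z *: z0], orthogonal to [a], so a test vector for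
   the projected list becomes one for [a :: s]. *)
have projE v z : dot (proj v) z = dot v (z + dot a z *: z0).
  by rewrite !dot_lin mulrC.
move=> z pz; rewrite projE; apply: imp => v; rewrite inE => /predU1P[->|vs].
  by rewrite dotDr dotZr az0 mulrN1 subrr.
by rewrite -projE pz // map_f.
Qed.

(** A short enough step from [xs] along [z] stays feasible, so it cannot lower the cost. *)
Lemma primal_optimal_direction (R : realType) (m n : nat) (A : 'M[R]_(m, n))
    (b : 'cV[R]_m) (c xs z : 'cV[R]_n) :
  primal_solution (A, b, c) xs -> A *m z = 0 ->
  (forall i, xs i 0 = 0 -> 0 <= z i 0) -> 0 <= dot c z.
Proof.
move=> [[Axs xs0] xsmin] Az z0.
(* With x / 0 = 0, only the positive coordinates of [xs] limit the step. *)
pose t := (1 + \sum_i `|z i 0| / xs i 0)^-1.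
have term0 i : 0 <= `|z i 0| / xs i 0 by rewrite divr_ge0.
have t0 : 0 < t by rewrite invr_gt0 ltr_pwDl // sumr_ge0.
suff : primal_feasible (A, b, c) (xs + t *: z).
  by move=> /xsmin; rewrite dotDr dotZr lerDl pmulr_rge0.
split; first by rewrite mulmxDr -scalemxAr Az scaler0 addr0.
move=> i; rewrite !mxE; have [xi0|xi0] := eqVneq (xs i 0) 0.
  by rewrite xi0 add0r mulr_ge0 ?z0 // ltW.
have xi : 0 < xs i 0 by rewrite lt_neqAle eq_sym xi0 xs0.
suff : t * `|z i 0| <= xs i 0.
  have : - (t * `|z i 0|) <= t * z i 0.
    by rewrite -mulrN ler_pM2l // lerNl -normrN ler_norm.
  lra.
rewrite mulrC ler_pdivrMr ?ltr_pwDl ?sumr_ge0 // mulrC -ler_pdivrMr //.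
by rewrite (bigD1 i) //= addrCA lerDl addr_ge0 // sumr_ge0.
Qed.

(** Farkas' lemma for the cone of all [A^T u + s] with [s >= 0] orthogonal to [xs], generated by the
    signed rows of [A] and the unit vectors where [xs] vanishes. Membership of [c] is dual
    feasibility with complementary slackness, which equates the objectives. *)
Lemma lp_dual_certificate (R : realType) (m n : nat) (A : 'M[R]_(m, n))
    (b : 'cV[R]_m) (c xs : 'cV[R]_n) :
  primal_solution (A, b, c) xs ->
  exists2 u, dual_feasible (A, b, c) u & dot b u = dot c xs.
Proof.
move=> xs_sol; have [[Axs xs0] _] := xs_sol.
pose K := [set v | exists u, nonneg (v - A^T *m u) /\
  dot (v - A^T *m u) xs = 0].
suff [u [cu cu0]] : K c.
  exists u => //; apply/esym/eqP.
  by rewrite -subr_eq0 -cu0 dotDl dotNl dot_trmul Axs (dotC u).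
pose e j : 'cV[R]_m := delta_mx j 0.
apply: (@farkas R n ([seq A^T *m e j | j <- enum 'I_m] ++
  [seq A^T *m - e j | j <- enum 'I_m] ++
  [seq delta_mx i 0 | i <- enum 'I_n & xs i 0 == 0])).
- by exists 0; rewrite mulmx0 subr0 dot0l; split => // i; rewrite mxE.
- move=> v w [u1 [s1 o1]] [u2 [s2 o2]]; exists (u1 + u2).
  rewrite mulmxDr opprD addrACA dotDl o1 o2 addr0; split => // i.
  by rewrite mxE addr_ge0.
- move=> t v t0 [u [s o]]; exists (t *: u).
  rewrite -scalemxAr -scalerBr dotZl o mulr0; split => // i.
  by rewrite mxE mulr_ge0.
- move=> a; rewrite !mem_cat => /or3P[] /mapP[j].
  + by move=> _ ->; exists (e j); rewrite subrr dot0l; split => // i;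
      rewrite mxE.
  + by move=> _ ->; exists (- e j); rewrite subrr dot0l; split => // i;
      rewrite mxE.
  + rewrite mem_filter => /andP[/eqP xj _] ->; exists 0.
    by rewrite mulmx0 subr0 dot_delta; split => // i; rewrite mxE.
(* Both signs of each row force [A *m z = 0], and the unit vectors give [z] its sign where [xs]
   vanishes. *)
move=> z gz; apply: primal_optimal_direction xs_sol _ _ => [|i xi].
  apply/colP => j; rewrite [RHS]mxE; apply/le_anti/andP; split.
    rewrite -oppr_ge0 -dot_delta -dotNl -dot_trmul; apply: gz.
    rewrite !mem_cat; apply/or3P/Or32/mapP.
    by exists j; rewrite ?mem_enum // mulmxN.
  rewrite -dot_delta -dot_trmul; apply: gz.
  by rewrite !mem_cat; apply/or3P/Or31/mapP; exists j; rewrite ?mem_enum.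
rewrite -dot_delta; apply: gz; rewrite !mem_cat; apply/or3P/Or33/mapP.
by exists i; rewrite // mem_filter xi eqxx mem_enum.
Qed.

(** One inequality is weak duality; the other compares [us] with the certificate. *)
Lemma lp_strong_duality (R : realType) (m n : nat) (A : 'M[R]_(m, n))
    (b : 'cV[R]_m) (c xs : 'cV[R]_n) (us : 'cV[R]_m) :
  primal_solution (A, b, c) xs -> dual_solution (A, b, c) us ->
  dot b us = dot c xs.
Proof.
move=> xs_sol [us_feas us_max]; have [[Axs xs0] _] := xs_sol.
have [u u_feas uE] := lp_dual_certificate xs_sol.
apply/le_anti; rewrite -{2}uE us_max // andbT -subr_ge0.
have := dot_nonneg_ge0 us_feas xs0.
by rewrite dotDl dotNl dot_trmul Axs (dotC us).
Qed.

(** * The quadratic objective: expansion, optimality condition, uniqueness *)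

(** The gradient of [f_beta], grouped so that the updated multiplier [ubar - beta *: (A *m x - b)]
    stands in the place of a dual variable. *)
Definition f_beta_grad (R : realType) (m n : nat) (A : 'M[R]_(m, n))
    (b : 'cV[R]_m) (c : 'cV[R]_n) (ubar : 'cV[R]_m) (xbar : 'cV[R]_n)
    (beta : R) (x : 'cV[R]_n) : 'cV[R]_n :=
  c - A^T *m (ubar - beta *: (A *m x - b)) + beta^-1 *: (x - xbar).

(** The objective is quadratic, so its second-order expansion is exact. *)
Lemma f_betaD (R : realType) (m n : nat) (A : 'M[R]_(m, n))
    (b : 'cV[R]_m) (c : 'cV[R]_n) (ubar : 'cV[R]_m) (xbar : 'cV[R]_n)
    (beta : R) (x h : 'cV[R]_n) :
  beta != 0 ->
  f_beta (A, b, c) ubar xbar beta (x + h) =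
  f_beta (A, b, c) ubar xbar beta x +
    dot (f_beta_grad A b c ubar xbar beta x) h +
    (beta / 2 * norm2 (A *m h) ^+ 2 + 1 / (2 * beta) * norm2 h ^+ 2).
Proof.
move=> beta0; rewrite /f_beta /f_beta_grad mulmxDr.
rewrite [x + h - xbar]addrAC [_ + _ *m h - b]addrAC.
rewrite !sqr_norm2 !dot_lin dot_trmul !dot_lin.
rewrite !(dotC (A *m h)) !(dotC h).
by field.
Qed.

Section Minimizer.
Variables (R : realType) (m n : nat) (A : 'M[R]_(m, n)) (b : 'cV[R]_m).
Variables (c : 'cV[R]_n) (ubar : 'cV[R]_m) (xbar : 'cV[R]_n) (beta : R).
Hypothesis beta_gt0 : 0 < beta.
Let f := f_beta (A, b, c) ubar xbar beta.
Let grad := f_beta_grad A b c ubar xbar beta.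

(** Strong convexity: of the quadratic remainder only the proximal term is kept. *)
Lemma f_beta_lower_bound x y :
  f x + dot (grad x) (y - x) + 1 / (2 * beta) * norm2 (y - x) ^+ 2 <= f y.
Proof.
rewrite -[in X in _ <= X](subrKC x y) /f f_betaD ?gt_eqF // -/f -/grad.
by rewrite lerD2l lerDr mulr_ge0 ?sqr_ge0 // divr_ge0 // ltW.
Qed.

Lemma f_beta_variational x y :
  is_argmin [set x | nonneg x] f x -> nonneg y -> 0 <= dot (grad x) (y - x).
Proof.
move=> [x0 xmin] y0; set h := y - x.
set q := beta / 2 * norm2 (A *m h) ^+ 2 + 1 / (2 * beta) * norm2 h ^+ 2.
have q0 : 0 <= q.
  by rewrite addr_ge0 // mulr_ge0 ?sqr_ge0 // divr_ge0 ?mulr_ge0 // ltW.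
rewrite leNgt; apply/negP => g0.
(* With slope [g < 0], the change along [t *: h] is [t (g + t q)]. The choice [t = - g / (q - g)]
   gives [t q = - g + t g < - g], keeps [t <= 1], and also covers [q = 0]. *)
pose t := - dot (grad x) h / (q - dot (grad x) h).
have t0 : 0 < t by rewrite divr_gt0 ?oppr_gt0 //; lra.
have t1 : t <= 1 by rewrite ler_pdivrMr; lra.
have : f x <= f (x + t *: h).
  apply: xmin => i; rewrite !mxE.
  have -> : x i 0 + t * (y i 0 - x i 0) = (1 - t) * x i 0 + t * y i 0 by ring.
  by rewrite addr_ge0 // mulr_ge0 // ?subr_ge0 // ltW.
rewrite /f f_betaD ?gt_eqF // -/f -/grad -scalemxAr !norm2Z dotZr.
rewrite !exprMn !real_normK ?num_real //.
have -> : beta / 2 * (t ^+ 2 * norm2 (A *m h) ^+ 2) +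
  1 / (2 * beta) * (t ^+ 2 * norm2 h ^+ 2) = t ^+ 2 * q by rewrite /q; ring.
have tE : t * (q - dot (grad x) h) = - dot (grad x) h by rewrite mulfVK //; lra.
have : t * q < - dot (grad x) h by nra.
nra.
Qed.

(** The variational inequality removes the linear term of the strong convexity bound, so equal
    minima force zero distance. *)
Lemma f_beta_argmin_unique x y :
  is_argmin [set x | nonneg x] f x -> is_argmin [set x | nonneg x] f y -> x = y.
Proof.
move=> xmin ymin; have [[x0 _] [y0 yle]] := (xmin, ymin).
have := f_beta_lower_bound x y; have := f_beta_variational xmin y0.
have := yle x x0; set g := dot _ _; set N := 1 / _ * _ => fyx g0 fxy.
have N0 : N <= 0 by lra.
apply/esym/eqP; rewrite -subr_eq0 -norm2_eq0 -sqrf_eq0 eq_le sqr_ge0 andbT.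
by rewrite -(@pmulr_rle0 _ (1 / (2 * beta))) ?divr_gt0 // mulr_gt0.
Qed.

End Minimizer.

(** * Existence of the minimizer *)

Lemma continuous_sumr (R : realType) (T : topologicalType) (I : finType)
    (F : I -> T -> R) :
  (forall i, continuous (F i)) -> continuous (fun x => \sum_i F i x : R).
Proof.
have addc : continuous (fun x : R * R => x.1 + x.2) by exact: add_continuous.
by move=> Fc x; apply: (continuous_big addc) => i _; exact: Fc.
Qed.

Lemma continuous_dot (R : realType) (n : nat) (v : 'cV[R]_n) :
  continuous (fun r : 'rV[R]_n => dot v r^T : R).
Proof.
under eq_fun do rewrite dotE.
move=> r0; apply: continuous_sumr => i r.
under eq_fun do rewrite mxE.
by apply: continuousM; [exact: cst_continuous|exact: coord_continuous].
Qed.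

Lemma continuous_sqr_norm2 (R : realType) (p n : nat) (M : 'M[R]_(p, n)) :
  continuous (fun r : 'rV[R]_n => norm2 (M *m r^T) ^+ 2 : R).
Proof.
under eq_fun do rewrite sqr_norm2 dotE.
move=> r0; apply: continuous_sumr => i r.
under eq_fun do rewrite -dot_delta -dot_trmul.
have dc := @continuous_dot R n (M^T *m delta_mx i 0).
exact: (continuousM (dc r) (dc r)).
Qed.

(** A minimum over the compact box with sides [[0, M]] is global: nonnegative points of norm above
    [M] have values at least [f 0]. *)
Lemma f_beta_argmin_exists (R : realType) (m n : nat) (A : 'M[R]_(m, n))
    (b : 'cV[R]_m) (c : 'cV[R]_n) (ubar : 'cV[R]_m) (xbar : 'cV[R]_n)
    (beta : R) :
  0 < beta ->
  exists x, is_argmin [set x | nonneg x] (f_beta (A, b, c) ubar xbar beta) x.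
Proof.
move=> beta_gt0; set f := f_beta _ _ _ _.
pose g := f_beta_grad A b c ubar xbar beta 0.
(* Beyond this radius [|y|^2 / (2 beta)] dominates [|g| |y|]. *)
pose M := 2 * beta * norm2 g.
have M0 : 0 <= M by rewrite !mulr_ge0 ?norm2_ge0 // ltW.
pose box := [set r : 'rV[R]_n | forall i, `[0, M]%classic (r ord0 i)].
have box0 : box 0 by move=> i /=; rewrite mxE in_itv /= lexx.
have box_compact : compact box.
  exact: (@rV_compact R n (fun=> `[0, M]%classic)
    (fun=> @segment_compact R 0 M)).
(* The factor [1%:M] gives both squared norms the form treated by [continuous_sqr_norm2]. *)
have fE r : f r^T = f 0 + dot g r^T +
    (beta / 2 * norm2 (A *m r^T) ^+ 2 +
     1 / (2 * beta) * norm2 (1%:M *m r^T) ^+ 2).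
  by rewrite mul1mx -f_betaD ?gt_eqF // add0r.
have f_cont : continuous (fun r : 'rV[R]_n => f r^T : R).
  under eq_fun do rewrite fE.
  have dotc := @continuous_dot R n g.
  have normc p a (B : 'M[R]_(p, n)) :
      continuous (fun r : 'rV[R]_n => a * norm2 (B *m r^T) ^+ 2 : R).
    by move=> r; exact: (continuousM (@cst_continuous _ _ a r)
      (@continuous_sqr_norm2 R p n B r)).
  move=> r; exact: (continuousD
    (continuousD (@cst_continuous _ _ (f 0) r) (dotc r))
    (continuousD (normc _ (beta / 2) A r) (normc _ (1 / (2 * beta)) 1%:M r))).
have [r] := compact_EVT_min (ex_intro _ 0 box0) box_compact
  (continuous_subspaceT f_cont).
rewrite inE => rbox rmin; exists r^T; split => [i|y y0].
  by rewrite mxE; have := rbox i; rewrite /= in_itv /= => /andP[].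
have [y_le|y_gt] := leP (norm2 y) M.
  rewrite -[y]trmxK; apply: rmin; rewrite inE => i /=.
  by rewrite mxE in_itv /= y0 (le_trans (coord_le_norm2 _ _)).
have f0 : f r^T <= f 0.
  by rewrite -[in X in _ <= X]trmx0; apply: rmin; rewrite inE.
apply: (le_trans f0).
have := f_beta_lower_bound A b c ubar xbar beta_gt0 0 y; rewrite subr0 -/f -/g.
apply: le_trans; rewrite -addrA lerDl.
have := dot_le_norm2 (- g) y; rewrite dotNl norm2N => gy.
have := ltW y_gt.
rewrite -(@ler_pM2l _ (1 / (2 * beta))) ?divr_gt0 ?mulr_gt0 //.
have -> : 1 / (2 * beta) * M = norm2 g by rewrite /M; field; rewrite gt_eqF.
move=> /(ler_wpM2r (norm2_ge0 y)); rewrite expr2; lra.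
Qed.

(** * Distances to infeasibility and the size of dual solutions *)

Lemma data_dist_le (R : realType) (m n : nat) (d d' : lpdata R m n)
    (S : set (lpdata R m n)) :
  S d' -> data_dist d S <= data_norm (data_sub d d').
Proof.
move=> Sd'; apply: ge_inf; last by exists d'.
exists 0 => _ [[[A' b'] c'] _ <-]; case: d => [[A b] c] /=.
by rewrite le_max norm2_ge0.
Qed.

Lemma trmx_mul_dot (R : realType) (p : nat) (v w : 'cV[R]_p) :
  v^T *m w = (dot v w)%:M.
Proof. exact: mx11_scalar. Qed.

(** The witness is [v / |v|^2]; it lets a rank-one change of a matrix prescribe the image of [v] at
    low cost. *)
Lemma dot_eq1_exists (R : realType) (p : nat) (v : 'cV[R]_p) :
  v != 0 -> exists2 w, dot v w = 1 & norm2 w = (norm2 v)^-1.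
Proof.
move=> v0; have nv : norm2 v != 0 by rewrite norm2_eq0.
exists (norm2 v ^- 2 *: v); first by rewrite dotZr -sqr_norm2 mulVf ?expf_neq0.
rewrite norm2Z ger0_norm ?invr_ge0 ?sqr_ge0 //.
by field.
Qed.

(* The perturbation [A - u c^T / |u|^2], [b + (K + e) u / |u|^2] makes [u] a
   Farkas certificate of primal infeasibility. *)
Lemma dist_primal_infeasible_le (R : realType) (m n : nat) (A : 'M[R]_(m, n))
    (b : 'cV[R]_m) (c : 'cV[R]_n) (u : 'cV[R]_m) (K : R) :
  dual_feasible (A, b, c) u -> norm2 c <= K -> - dot b u <= K ->
  data_dist (A, b, c) (@primal_infeasible R m n) * norm2 u <= K.
Proof.
move=> u_feas cK buK; have K0 : 0 <= K by rewrite (le_trans _ cK) ?norm2_ge0.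
have [->|u0] := eqVneq u 0; first by rewrite norm2_mx0 mulr0.
have nu : 0 < norm2 u by rewrite norm2_gt0.
apply/ler_addgt0Pr => e e0; rewrite -ler_pdivlMr //.
have [w uw nw] := dot_eq1_exists u0.
pose A' := A - w *m c^T.
pose b' := b + (K + e) *: w.
apply: le_trans (data_dist_le (A, b, c) (d' := (A', b', c)) _) _.
  rewrite /primal_infeasible /=.
  apply/eqP; apply: contraT => /set0P[x [A'x x0]].
  (* For a feasible [x], [u.b'] is at least [e > 0], yet it equals [- (c - A^T u).x <= 0]. *)
  have : dot u b' = dot b u + K + e by rewrite !dot_lin uw mulr1 dotC addrA.
  have : dot u b' = - dot (c - A^T *m u) x.
    rewrite -A'x -dot_trmul /A' linearB /= trmx_mul trmxK mulmxBl -mulmxA.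
    by rewrite trmx_mul_dot (dotC w) uw mulmx1 -dotNl opprB.
  have := dot_nonneg_ge0 u_feas x0; lra.
rewrite /data_norm /data_sub /A' /b' subrr norm2_mx0 subKr opprD addNKr.
rewrite norm2N norm2_outer norm2Z nw.
rewrite ger0_norm; last by lra.
rewrite mulrC !ge_max ler_pM2r ?invr_gt0 //.
by rewrite divr_ge0 ?lexx //; lra.
Qed.

(** Subtracting [b x^T / |x|^2] from [A] and [(K + e) x / |x|^2] from [c] gives [A' x = 0] and
    [c'.x < 0] with [x >= 0], which certifies dual infeasibility. *)
Lemma dist_dual_infeasible_le (R : realType) (m n : nat) (A : 'M[R]_(m, n))
    (b : 'cV[R]_m) (c : 'cV[R]_n) (x : 'cV[R]_n) (K : R) :
  primal_feasible (A, b, c) x -> norm2 b <= K -> dot c x <= K ->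
  data_dist (A, b, c) (@dual_infeasible R m n) * norm2 x <= K.
Proof.
move=> [Ax x0] bK cxK; have K0 : 0 <= K by rewrite (le_trans _ bK) ?norm2_ge0.
have [->|xn0] := eqVneq x 0; first by rewrite norm2_mx0 mulr0.
have nx : 0 < norm2 x by rewrite norm2_gt0.
apply/ler_addgt0Pr => e e0; rewrite -ler_pdivlMr //.
have [w wx nw] := dot_eq1_exists xn0.
pose A' := A - b *m w^T.
pose c' := c - (K + e) *: w.
apply: le_trans (data_dist_le (A, b, c) (d' := (A', b, c')) _) _.
  rewrite /dual_infeasible /=.
  apply/eqP; apply: contraT => /set0P[u u_feas].
  have : dot c' x = dot c x - (K + e) by rewrite !dot_lin (dotC w) wx mulr1.
  have A'x : A' *m x = 0.
    by rewrite mulmxBl -mulmxA trmx_mul_dot (dotC w) wx mulmx1 Ax subrr.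
  have := dot_nonneg_ge0 u_feas x0.
  rewrite dotDl dotNl dot_trmul A'x (dotC u) dot0l; lra.
rewrite /data_norm /data_sub /A' /c' subrr norm2_mx0 !subKr.
rewrite norm2_outer norm2Z nw.
rewrite ger0_norm; last by lra.
rewrite !ge_max !ler_pM2r ?invr_gt0 //.
by rewrite divr_ge0 ?lexx ?andbT //=; lra.
Qed.

Lemma data_norm_ge0 (R : realType) (m n : nat) (d : lpdata R m n) :
  0 <= data_norm d.
Proof. by case: d => [[A b] c] /=; rewrite le_max norm2_ge0. Qed.

(** Replacing [A] by zero and [c] by a small negative multiple of a unit vector destroys dual
    feasibility. This gives [delta_D d <= 1]. *)
Lemma dist_dual_infeasible_le_data_norm (R : realType) (m n : nat)
    (d : lpdata R m n) :
  data_dist d (@dual_infeasible R m n) <= data_norm d.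
Proof.
case: n d => [|n] d.
  (* For [n = 0] every [u] is dual feasible, and the [inf] of the empty set is 0. *)
  have -> : @dual_infeasible R m 0 = set0.
    apply/seteqP; split => [[[A b] c] /= infeas|//].
    by suff : set0 (0 : 'cV[R]_m) by []; rewrite -infeas => -[].
  by rewrite /data_dist image_set0 inf0 data_norm_ge0.
case: d => [[A b] c]; apply/ler_addgt0Pr => e e0.
apply: le_trans
  (data_dist_le (A, b, c) (d' := (0, b, - (e *: delta_mx ord0 0))) _) _.
  rewrite /dual_infeasible /=.
  apply/eqP; apply: contraT => /set0P[u /(_ ord0)].
  by rewrite trmx0 mul0mx subr0 !mxE !eqxx mulr1 oppr_ge0 leNgt e0.
rewrite /data_norm /data_sub subr0 subrr norm2_mx0 opprK !ge_max.
have normce : norm2 (c + e *: delta_mx ord0 0) <= norm2 c + e.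
  rewrite (le_trans (norm2D _ _)) // lerD2l norm2Z gtr0_norm // norm2E.
  by rewrite dot_delta mxE !eqxx sqrtr1 mulr1.
set M := Num.max _ _.
have AM : norm2 A <= M by rewrite le_max lexx.
have cM : norm2 c <= M by rewrite !le_max lexx !orbT.
apply/and3P; split; have := norm2_ge0 A; lra.
Qed.

(** The number [|c| / delta_D] bounds both [|c|] and [- b.us], so it can serve as [K] in
    [dist_primal_infeasible_le]. *)
Lemma norm2_dual_solution_le (R : realType) (m n : nat) (A : 'M[R]_(m, n))
    (b : 'cV[R]_m) (c xs : 'cV[R]_n) (us : 'cV[R]_m) :
  let d : lpdata R m n := (A, b, c) in
  0 < delta_P d -> 0 < delta_D d ->
  primal_solution d xs -> dual_solution d us ->
  delta_P d * delta_D d * norm2 us <= 1.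
Proof.
move=> d dP dD xs_sol us_sol.
(* A zero norm would make [delta_P d] equal to 0, since [x / 0 = 0]. *)
have N0 : 0 < data_norm d.
  rewrite lt_neqAle data_norm_ge0 andbT; apply/eqP => N0.
  by move: dP; rewrite /delta_P -N0 invr0 mulr0 ltxx.
have PE : data_dist d (@primal_infeasible R m n) = delta_P d * data_norm d.
  by rewrite divfK // gt_eqF.
have DE : data_dist d (@dual_infeasible R m n) = delta_D d * data_norm d.
  by rewrite divfK // gt_eqF.
have bN : norm2 b <= data_norm d by rewrite !le_max lexx orbT.
have cN : norm2 c <= data_norm d by rewrite !le_max lexx !orbT.
have dD1 : delta_D d <= 1.
  by rewrite ler_pdivrMr // mul1r dist_dual_infeasible_le_data_norm.
have c0 := norm2_ge0 c.
have cK : norm2 c <= norm2 c / delta_D d.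
  by rewrite ler_pdivlMr // ler_piMr.
have buK : - dot b us <= norm2 c / delta_D d.
  rewrite (lp_strong_duality xs_sol us_sol).
  (* A nonnegative optimal value is immediate; a negative one bounds [norm2 xs] by [1 / delta_D]
     through the distance to dual infeasibility. *)
  have [cx0|cx0] := leP 0 (dot c xs).
    by rewrite (@le_trans _ _ 0) ?oppr_le0 // divr_ge0 // ltW.
  have [xs_feas _] := xs_sol.
  have := dist_dual_infeasible_le xs_feas (lexx _) _.
  rewrite -/d DE => /(_ (le_trans (ltW cx0) (norm2_ge0 _))) xb.
  have x1 : norm2 xs <= (delta_D d)^-1.
    rewrite -[leRHS]mul1r ler_pdivlMr // -(ler_pM2r N0) mul1r.
    by rewrite -mulrA mulrC (le_trans xb).
  rewrite -dotNl (le_trans (dot_le_norm2 _ _)) // norm2N.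
  by rewrite ler_wpM2l.
have [us_feas _] := us_sol.
have := dist_primal_infeasible_le us_feas cK buK; rewrite -/d PE.
rewrite ler_pdivlMr // => H.
rewrite -(ler_pM2r N0) mul1r (le_trans _ cN) // (le_trans _ H) //.
by rewrite le_eqVlt; apply/orP; left; apply/eqP; ring.
Qed.

(** * Estimates for the minimizer *)

Lemma f_beta_argmin_estimates (R : realType) (m n : nat) (A : 'M[R]_(m, n))
    (b : 'cV[R]_m) (c xs : 'cV[R]_n) (us ubar : 'cV[R]_m) (xbar x : 'cV[R]_n)
    (beta C : R) :
  primal_solution (A, b, c) xs -> dual_solution (A, b, c) us -> 0 < beta ->
  norm2 (xs - xbar) <= C -> norm2 (us - ubar) <= C ->
  is_argmin [set x | nonneg x] (f_beta (A, b, c) ubar xbar beta) x ->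
  [/\ (beta * norm2 (A *m x - b)) ^+ 2 <= 2 * C ^+ 2,
      norm2 (x - xs) ^+ 2 <= 2 * C ^+ 2
    & beta * `|dot c (x - xs)| <=
        C ^+ 2 + norm2 us * (beta * norm2 (A *m x - b))].
Proof.
move=> xs_sol us_sol beta0 xC uC xmin.
have [[[[Axs xs0] _] [us_feas _]] [x0 _]] := (xs_sol, us_sol, xmin).
set e := x - xs; pose p := x - xbar.
have Ae : A *m e = A *m x - b by rewrite mulmxBr Axs.
(* [q] is the multiplier step from [ubar] and [v] the new multiplier error, so [p - e] and [q - v]
   are the initial errors. *)
pose q := - (beta *: (A *m x - b)); pose v := ubar + q - us.
have qE : norm2 q = beta * norm2 (A *m x - b).
  by rewrite norm2N norm2Z gtr0_norm.
have rq : A *m x - b = - beta^-1 *: q.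
  by rewrite scaleNr scalerN opprK scalerA mulVf ?scale1r // gt_eqF.
have gradE : f_beta_grad A b c ubar xbar beta x =
    c - A^T *m (us + v) + beta^-1 *: p.
  by rewrite /f_beta_grad -/q (addrC us) subrK.
have pe : p - e = xs - xbar by rewrite /p /e opprB addrC addrA subrK.
have qv : q - v = us - ubar.
  by rewrite /v opprB addrCA (addrC ubar) opprD addNKr.
clearbody p q v.
(* The variational inequality tested at [xs], multiplied by [beta]. *)
have upper : beta * dot c e <= - dot us q - (dot v q + dot p e).
  have := f_beta_variational beta0 xmin xs0.
  rewrite gradE -(opprB x xs) -/e dotNr !(dotDl, dotNl, dotZl) dot_trmul Ae rq.
  rewrite dotZr dotDl.
  set t := - _; have -> : t =
    beta^-1 * (- dot us q - (dot v q + dot p e) - beta * dot c e).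
    by rewrite /t; field; rewrite gt_eqF.
  by rewrite pmulr_rge0 ?invr_gt0 // subr_ge0.
(* Dual feasibility of [us] tested on [x >= 0], with strong duality replacing [us.b] by [c.xs]. *)
have lower : - dot us q <= beta * dot c e.
  have := dot_nonneg_ge0 us_feas x0.
  have := lp_strong_duality xs_sol us_sol.
  rewrite dotDl dotNl dot_trmul -(subrK b (A *m x)) rq dotDr dotZr (dotC us b).
  move=> ->; rewrite /e dotDr dotNr.
  set t := dot c x - _ => t0.
  have : 0 <= beta * t by rewrite mulr_ge0 // ltW.
  have -> : beta * t = beta * (dot c x - dot c xs) + dot us q.
    by rewrite /t; field; rewrite gt_eqF.
  lra.
clearbody e.
(* Monotonicity of the saddle operator between [(x, ubar + q)] and
   [(xs, us)]. *)
have mono : dot v q + dot p e <= 0 by lra.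
have xC2 : norm2 (p - e) ^+ 2 <= C ^+ 2.
  by rewrite pe ler_sqr ?nnegrE ?norm2_ge0 // (le_trans (norm2_ge0 _) xC).
have uC2 : norm2 (q - v) ^+ 2 <= C ^+ 2.
  by rewrite qv ler_sqr ?nnegrE ?norm2_ge0 // (le_trans (norm2_ge0 _) xC).
(* Expanding the two initial errors with [mono] bounds the sum of the squares of [p], [e], [q], [v]
   by [2 C^2]. The same expansions bound [- (v.q + p.e)] by [C^2]. *)
move: xC2 uC2 (dotvv_ge0 (p + e)) (dotvv_ge0 (q + v)).
have := dot_le_norm2 us q; have := dot_le_norm2 us (- q).
rewrite norm2N dotNr -qE !sqr_norm2 !dot_lin (dotC e p) (dotC v q).
have := dotvv_ge0 p; have := dotvv_ge0 q; have := dotvv_ge0 e.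
have := dotvv_ge0 v; move: mono upper; rewrite (dotC v q).
move=> *; split; [lra|lra|].
by rewrite -{1}(gtr0_norm beta0) -normrM ler_norml; apply/andP; split; lra.
Qed.

Theorem theorem4 (R : realType) (m n : nat)
    (A : 'M[R]_(m, n)) (b : 'cV[R]_m) (c : 'cV[R]_n)
    (A_full_row_rank : \rank A = m)
    (delta_P_gt0 : 0 < delta_P (A, b, c))
    (delta_D_gt0 : 0 < delta_D (A, b, c))
    (xs : 'cV[R]_n) (us : 'cV[R]_m)
    (xs_sol : primal_solution (A, b, c) xs)
    (us_sol : dual_solution (A, b, c) us)
    (ubar : 'cV[R]_m) (xbar : 'cV[R]_n)
    (beta : R) (beta_gt0 : 0 < beta) :
  let d : lpdata R m n := (A, b, c) in
  let Cs := Num.max (norm2 (xs - xbar)) (norm2 (us - ubar)) in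
  let is_xbeta := is_argmin [set x | nonneg x] (f_beta d ubar xbar beta) in
  (exists! x, is_xbeta x) /\
  forall xb : 'cV[R]_n, is_xbeta xb ->
    [/\ norm2 (A *m xb - b) <= 1 / beta * (1 + Num.sqrt 2) * Cs,
        norm2 (xb - xs) <= Num.sqrt 6 * Cs
      & 10 * Cs / (data_norm d * Num.min (delta_P d) (delta_D d)) <= beta ->
        `|dot c xs - dot c xb| <=
          1 / beta * (25 * Cs / (2 * delta_P d * delta_D d)
                      + 6 * Cs ^+ 2
                      + Num.sqrt 6 * norm2 xbar * Cs)].
Proof.
move=> d Cs is_xbeta; split.
  have [x xmin] := f_beta_argmin_exists A b c ubar xbar beta_gt0.
  by exists x; split=> // y; exact: f_beta_argmin_unique.
move=> xb xbmin.
have xC : norm2 (xs - xbar) <= Cs by rewrite le_max lexx.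
have uC : norm2 (us - ubar) <= Cs by rewrite le_max lexx orbT.
have C0 : 0 <= Cs := le_trans (norm2_ge0 _) xC.
have [r2 e2 obj] :=
  f_beta_argmin_estimates xs_sol us_sol beta_gt0 xC uC xbmin.
have r0 : 0 <= beta * norm2 (A *m xb - b) by rewrite mulr_ge0 ?norm2_ge0 // ltW.
(* Used with [a = 2] for the residual and [a = 6] for the distance to [xs]. *)
have le_sqrtC a z : 2 <= a -> 0 <= z -> z ^+ 2 <= 2 * Cs ^+ 2 ->
    z <= Num.sqrt a * Cs.
  move=> a2 z0 z2; rewrite -ler_sqr ?nnegrE ?mulr_ge0 ?sqrtr_ge0 //.
  rewrite exprMn sqr_sqrtr; last by lra.
  by rewrite (le_trans z2) // ler_wpM2r ?sqr_ge0.
have rC := le_sqrtC 2 _ (lexx _) r0 r2.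
split.
- rewrite -(ler_pM2l beta_gt0) (le_trans rC) // div1r -mulrA.
  by rewrite mulVKf ?gt_eqF // ler_wpM2r // lerDr.
- by apply: le_sqrtC e2; rewrite ?norm2_ge0 // ler_nat.
move=> _; rewrite -(ler_pM2l beta_gt0) distrC -dotNr -dotDr (le_trans obj) //.
rewrite div1r mulVKf ?gt_eqF //.
have us_le := norm2_dual_solution_le delta_P_gt0 delta_D_gt0 xs_sol us_sol.
have sqrt2 : Num.sqrt 2 <= 2 :> R.
  by rewrite -ler_sqr ?nnegrE ?sqrtr_ge0 // sqr_sqrtr //; lra.
have rC2 : beta * norm2 (A *m xb - b) <= 2 * Cs.
  by rewrite (le_trans rC) // ler_wpM2r.
have PD0 : 0 < delta_P d * delta_D d := mulr_gt0 delta_P_gt0 delta_D_gt0.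
(* Multiplied by [2 delta_P delta_D], the left side is at most [4 Cs], below [25 Cs]. *)
have us_bound : norm2 us * (beta * norm2 (A *m xb - b)) <=
    25 * Cs / (2 * delta_P d * delta_D d).
  rewrite ler_pdivlMr; last by rewrite -mulrA (pmulr_rgt0 _ (ltr0Sn _ 1)).
  apply: (@le_trans _ _ (delta_P d * delta_D d * norm2 us * (4 * Cs))).
    rewrite [leLHS](_ : _ = delta_P d * delta_D d * norm2 us *
      (2 * (beta * norm2 (A *m xb - b)))); last by ring.
    apply: ler_wpM2l; last by lra.
    by rewrite mulr_ge0 ?norm2_ge0 // ltW.
  by apply: (@le_trans _ _ (1 * (4 * Cs))); [rewrite ler_wpM2r // mulr_ge0|lra].
have slack : 0 <= Num.sqrt 6 * norm2 xbar * Cs.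
  by rewrite !mulr_ge0 ?sqrtr_ge0 ?norm2_ge0.
have := sqr_ge0 Cs; lra.
Qed.
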